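(* Let $I\subset[0,\infty)$ be an interval with interior $I^{\circ}$, and let $f:I\to\mathbb{R}$ be a twice differentiable function on $I^{\circ}$ such that $f''\in L_1[a,b]$, where $a,b\in I$ with $a<b$. Let $p,q>1$ with $\frac1p+\frac1q=1$. If $|f''|^q$ is $s$-convex in the second sense on $[a,b]$ for some fixed $s\in(0,1]$, then for each $x\in[a,b]$ $$\left|\frac{1}{b-a}\int_a^b f(u)\,du-f(x)+\left(x-\frac{a+b}{2}\right)f'(x)\right|\le\frac{(x-a)^3}{2(b-a)}\left(\frac{1}{2p+1}\right)^{\frac1p}\left(\frac{|f''(x)|^q+|f''(a)|^q}{s+1}\right)^{\frac1q}+\frac{(b-x)^3}{2(b-a)}\left(\frac{1}{2p+1}\right)^{\frac1p}\left(\frac{|f''(x)|^q+|f''(b)|^q}{s+1}\right)^{\frac1q}.$$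
   Context: For fixed $s\in(0,1]$, a real-valued function $g$ is $s$-convex in the second sense on $[a,b]\subset[0,\infty)$ if $g(ty+(1-t)z)\le t^s g(y)+(1-t)^s g(z)$ for all $y,z\in[a,b]$ and $t\in[0,1]$. $L_1[a,b]$ denotes the Lebesgue integrable functions on $[a,b]$. *)

(* Defs.v *)
From HB Require Import structures.
From mathcomp Require Import all_boot all_order all_algebra.
From mathcomp Require Import all_classical all_reals all_analysis.
Set Implicit Arguments.
Unset Strict Implicit.
Unset Printing Implicit Defensive.
Import Order.TTheory GRing.Theory Num.Theory.
Import numFieldNormedType.Exports.
Local Open Scope classical_set_scope.
Local Open Scope ring_scope.

(* A function f : I -> R is represented by a total function R -> R of which only
   the values on I matter: the increments h below are restricted to those with
   h + y in I. At an interior point of I this is the usual derivative (lemmas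
   below); at an endpoint of I belonging to I it is the one-sided derivative. *)
Definition derivable_within (R : realType) (I : set R) (f : R -> R) (y : R) :=
  cvg (h^-1 *: (f (h + y) - f y) @[h --> within [set h | I (h + y)] 0^']).

Definition derive1_within (R : realType) (I : set R) (f : R -> R) (y : R) : R :=
  lim (h^-1 *: (f (h + y) - f y) @[h --> within [set h | I (h + y)] 0^']).

Definition twice_derivable_within (R : realType) (I A : set R) (f : R -> R) :=
  forall y, A y ->
    derivable_within I f y /\ derivable_within I (derive1_within I f) y.

Definition s_convex_second (R : realType) (s a b : R) (g : R -> R) :=
  forall y z t : R, y \in `[a, b] -> z \in `[a, b] -> t \in `[0, 1] ->
    g (t * y + (1 - t) * z) <= t `^ s * g y + (1 - t) `^ s * g z.

Lemma within_interior_dnbhs0 (R : realType) (I : set R) (y : R) :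
  I° y -> within [set h | I (h + y)] 0^' = (0 : R)^'.
Proof.
move=> Iy; apply/seteqP; split=> P; rewrite /within /= => HP; last first.
  by apply: filterS HP.
have HI : \forall h \near (0 : R)^', I (h + y).
  apply: nbhs_dnbhs.
  have : (h + y) @[h --> (0 : R)] --> 0 + y.
    by apply: cvgD; [exact: cvg_id|exact: cvg_cst].
  by rewrite add0r; apply.
by apply: filterS2 HI HP => h Ih; exact.
Qed.

Lemma derivable_within_interior (R : realType) (I : set R) (f : R -> R) (y : R) :
  I° y -> derivable_within I f y <-> derivable f y 1.
Proof.
move=> Iy; rewrite /derivable_within within_interior_dnbhs0// /derivable.
by under [in X in _ <-> X]eq_fun do rewrite [_ *: 1]mulr1.
Qed.

Lemma derive1_within_interior (R : realType) (I : set R) (f : R -> R) (y : R) :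
  I° y -> derive1_within I f y = derive1 f y.
Proof. by move=> Iy; rewrite /derive1_within within_interior_dnbhs0. Qed.

Lemma derivable2_within_interior (R : realType) (I : set R) (f : R -> R) (y : R) :
  I° y -> derivable_within I (derive1_within I f) y <-> derivable (derive1 f) y 1.
Proof.
move=> Iy; apply: iff_trans (derivable_within_interior _ Iy) _.
have E : \forall z \near y, derive1_within I f z = derive1 f z.
  exact: filterS (@derive1_within_interior R I f) (nbhs_interior Iy).
split; first exact: near_eq_derivable.
by apply: near_eq_derivable; apply: filterS E => z ->.
Qed.

Lemma derive2_within_interior (R : realType) (I : set R) (f : R -> R) (y : R) :
  I° y -> derive1_within I (derive1_within I f) y = derive1n 2 f y.
Proof.
move=> Iy; rewrite (derive1_within_interior _ Iy) derive1nS derive1n1.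
rewrite (derive1E (derive1_within I f)) (derive1E (derive1 f)).
apply: near_eq_derive.
exact: filterS (@derive1_within_interior R I f) (nbhs_interior Iy).
Qed.

(* Main.v *)
Require Import Defs.
From mathcomp Require Import all_boot all_order all_algebra.
From mathcomp Require Import all_classical all_reals all_analysis.
From mathcomp Require Import ring lra.
Import Order.TTheory GRing.Theory Num.Theory.
Import numFieldNormedType.Exports.
Local Open Scope classical_set_scope.
Local Open Scope ring_scope.

(** With F a primitive of f and c an endpoint of [a, b], the function
    E_c(u) = F(u) - F(c) - (u - c) f(u) + (u - c)^2 f'(u) / 2 vanishes at c and
    has derivative (u - c)^2 f''(u) / 2 on ]a, b[; the quantity to bound is
    (E_a(x) - E_b(x)) / (b - a). Along u = c + t (x - c), s-convexity bounds
    |f''(u)|^q by t^s |f''(x)|^q + (1 - t)^s |f''(c)|^q, and Young's inequality,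
    normalized as in the usual proof of Hoelder's inequality, then bounds
    t^2 |f''(u)| by a function of t with an explicit primitive. The mean value
    theorem compares the two increments over [0, 1], so that f'' is never
    integrated. *)

(** * Comparison of increments over an interval *)

Lemma within_continuous_comp_in {S T U : topologicalType} {A : set S}
    {B : set T} {g : S -> T} {f : T -> U} :
  {within A, continuous g} -> {within B, continuous f} ->
  (forall x, A x -> B (g x)) -> {within A, continuous (f \o g)}.
Proof.
move=> /subspace_continuousP cg /subspace_continuousP cf AB.
apply/subspace_continuousP => x Ax P /(cf _ (AB x Ax)).
rewrite /= /within /= => /(cg x Ax); rewrite /= /within /=.
rewrite !nbhs_simpl /=.
apply: filterS => y + Ay; apply; [exact: Ay|exact: AB].
Qed.

(** The derivatives of [g + f] and [g - f] are nonnegative on the open interval, so the mean value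
    theorem, applied to each, gives one half of the absolute value bound. *)
Lemma norm_increment_le (R : realType) (f g df dg : R -> R) (a b : R) :
  a < b ->
  (forall x, x \in `]a, b[ -> is_derive x 1 f (df x)) ->
  (forall x, x \in `]a, b[ -> is_derive x 1 g (dg x)) ->
  {within `[a, b], continuous f} -> {within `[a, b], continuous g} ->
  (forall x, x \in `]a, b[ -> `|df x| <= dg x) ->
  `|f b - f a| <= g b - g a.
Proof.
move=> ab df_ dg_ cf cg le_d; rewrite ler_norml; apply/andP; split.
  have [x xab e] := MVT ab (fun x hx => is_deriveD (dg_ x hx) (df_ x hx))
    (within_continuousD cg cf).
  have : 0 <= (dg x + df x) * (b - a).
    apply: mulr_ge0; last by rewrite subr_ge0 ltW.
    by have := le_d x xab; rewrite ler_norml => /andP[]; lra.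
  by rewrite -e !fctE; lra.
have [x xab e] := MVT ab (fun x hx => is_deriveB (dg_ x hx) (df_ x hx))
  (within_continuousB cg cf).
have : 0 <= (dg x - df x) * (b - a).
  apply: mulr_ge0; last by rewrite subr_ge0 ltW.
  by have := le_d x xab; rewrite ler_norml => /andP[]; lra.
by rewrite -e !fctE; lra.
Qed.

(** * Real powers on the unit interval *)

Lemma within_continuous_powR {R : realType} {r : R} : 0 < r ->
  {within `[0, 1], continuous (fun t : R => t `^ r)}.
Proof.
move=> r0; apply/continuous_within_itvP; first exact: ltr01.
have d (x : R) : 0 < x -> {for x, continuous (fun t : R => t `^ r)}.
  move=> x0; apply/differentiable_continuous; rewrite -derivable1_diffP.
  by apply: derivable_powR; rewrite in_itv/= x0.
split.
- by move=> x; rewrite in_itv/= => /andP[x0 _]; exact: d.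
(* Differentiability is only available at positive points. At 0 the right limit is used, and the
   value there is 0 because [r] is nonzero. *)
- by rewrite powR0 ?gt_eqF//; exact: powR_cvg0.
- by apply: cvg_at_left_filter; exact: d.
Qed.

Lemma within_continuous_powR_onem {R : realType} {r : R} : 0 < r ->
  {within `[0, 1], continuous (fun t : R => (1 - t) `^ r)}.
Proof.
move=> r0; apply: (@within_continuous_comp_in R R R `[0, 1] `[0, 1]
  (fun t => 1 - t) (fun t => t `^ r)).
- by apply: continuous_subspaceT => x; apply: cvgB; [exact: cvg_cst|exact: cvg_id].
- exact: within_continuous_powR.
- by move=> x /=; rewrite !in_itv/= => /andP[]; lra.
Qed.

Lemma is_derive_powR_antiderivative (R : realType) (r t : R) : 0 < t ->
  is_derive t 1 (fun t : R => t `^ (r + 1)) ((r + 1) * t `^ r).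
Proof. by move=> t0; have := is_derive1_powR (r + 1) t0; rewrite addrK. Qed.

Lemma is_derive_powR_onem (R : realType) (r t : R) : t < 1 ->
  is_derive t 1 (fun t : R => (1 - t) `^ (r + 1)) (- ((r + 1) * (1 - t) `^ r)).
Proof.
move=> t1; have t0 : 0 < 1 - t by rewrite subr_gt0.
have := @is_derive_powR_antiderivative R r _ t0 => dp.
have dl : is_derive t 1 (fun t : R => 1 - t) (- 1).
  have := is_deriveB (is_derive_cst (1 : R) t 1) (is_derive_id t 1).
  by rewrite sub0r.
have := @is_derive1_comp R (fun u => u `^ (r + 1)) (fun u => 1 - u) t _ _ dp dl.
by rewrite mulrN1.
Qed.

(** * The Hölder-type estimate over the unit interval *)

(** Young's inequality for the normalized factors [t ^+ 2 / P]^ p^-1[and]|k| / Q [^ q^-1]. The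
    weights are free here; they are meant to be the integrals over [0, 1] of t^(2p) and of [psi],
    for which the bracket has integral 1/p + 1/q = 1. *)
Lemma young_weighted (R : realType) (p q P Q t k psi : R) :
  0 < p -> 0 < q -> p^-1 + q^-1 = 1 -> 0 < P -> 0 < Q -> 0 <= t ->
  `|k| `^ q <= psi ->
  `|t ^+ 2 * k| <=
    P `^ p^-1 * Q `^ q^-1 * (t `^ (2 * p) / (P * p) + psi / (Q * q)).
Proof.
move=> p0 q0 pq P0 Q0 t0 kpsi.
have P1 : 0 < P `^ p^-1 by rewrite powR_gt0.
have Q1 : 0 < Q `^ q^-1 by rewrite powR_gt0.
rewrite normrM ger0_norm ?exprn_ge0//.
have -> : t ^+ 2 * `|k| = P `^ p^-1 * Q `^ q^-1 *
    ((t ^+ 2 / P `^ p^-1) * (`|k| / Q `^ q^-1)).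
  by field; rewrite !gt_eqF.
rewrite ler_pM2l ?mulr_gt0//.
rewrite -(powR_mulrn 2 t0).
apply: le_trans (conjugate_powR _ _ p0 q0 pq) _.
- by rewrite divr_ge0 ?powR_ge0.
- by rewrite divr_ge0 ?powR_ge0.
have inv r z : 0 < r -> 0 < z -> ((z `^ r^-1)^-1) `^ r = z^-1.
  move=> r0 z0; rewrite -powRN -powRrM mulNr mulVf ?gt_eqF// powR_inv1//.
  exact: ltW.
rewrite !powRM ?invr_ge0 ?powR_ge0 ?(ltW P1) ?(ltW Q1)// !inv//.
rewrite -powRrM !invfM !mulrA lerD2l.
by rewrite !ler_pM2r ?invr_gt0.
Qed.

Lemma norm_increment_le_s_convex {R : realType} {A B p q s : R} {D k : R -> R} :
  0 <= A -> 0 <= B -> 0 < p -> 0 < q -> p^-1 + q^-1 = 1 -> 0 < s ->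
  (forall t : R, t \in `]0, 1[ -> is_derive t 1 D (t ^+ 2 * k t)) ->
  {within `[0, 1], continuous D} ->
  (forall t : R, t \in `]0, 1[ -> `|k t| `^ q <= t `^ s * A + (1 - t) `^ s * B) ->
  `|D 1 - D 0| <= (2 * p + 1)^-1 `^ p^-1 * ((A + B) / (s + 1)) `^ q^-1.
Proof.
move=> A0 B0 p0 q0 pq s0 dD cD hk.
have s1 : 0 < s + 1 by rewrite addr_gt0.
have p1 : 0 < 2 * p + 1 by rewrite addr_gt0// mulr_gt0.
(* If A + B = 0, the weight [Q] below would vanish and could not be divided by. Then A = B = 0
   forces k to vanish on ]0, 1[, so D has zero increment. *)
have [AB|AB] := eqVneq (A + B) 0.
  have /andP[/eqP AE /eqP BE] : (A == 0) && (B == 0) by rewrite -paddr_eq0// AB.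
  rewrite AE BE addr0 mul0r powR0 ?invr_neq0 ?gt_eqF// mulr0.
  have dD0 (t : R) : t \in `]0, 1[ -> is_derive t 1 D 0.
    move=> t01; have := dD t t01; have := hk t t01.
    rewrite AE BE !mulr0 addr0 => /(conj (powR_ge0 `|k t| q))/andP/le_anti/esym.
    by move=> /powR_eq0_eq0/normr0P/eqP ->; rewrite mulr0.
  have [t _ ->] := MVT ltr01 dD0 cD.
  by rewrite mul0r normr0.
have AB0 : 0 < A + B by rewrite lt_neqAle eq_sym AB addr_ge0.
(* [P] and [Q] are the integrals over [0, 1] of t^(2p) and of A t^s + B (1 - t)^s. *)
pose P := (2 * p + 1)^-1; pose Q := (A + B) / (s + 1).
have P0 : 0 < P by rewrite invr_gt0.
have Q0 : 0 < Q by rewrite divr_gt0.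
pose K := P `^ p^-1 * Q `^ q^-1.
(* [W] is the explicit primitive on ]0, 1[ of the Young bound [dW]; its increment is K (1/p + 1/q) =
   K. *)
pose W (t : R) := K * (p^-1 * t `^ (2 * p + 1)
  + ((s + 1) * (Q * q))^-1 * (A * t `^ (s + 1) - B * (1 - t) `^ (s + 1))).
pose dW (t : R) := K * (t `^ (2 * p) / (P * p)
  + (t `^ s * A + (1 - t) `^ s * B) / (Q * q)).
have W01 : W 1 - W 0 = K.
  rewrite /W subrr subr0 !powR1 !powR0 ?gt_eqF//.
  transitivity (K * (p^-1 + q^-1)); last by rewrite pq mulr1.
  rewrite /Q; field.
  by rewrite !gt_eqF.
rewrite -/P -/Q -/K -W01.
apply: (norm_increment_le R D W _ dW _ _ ltr01 dD _ cD).
- move=> t; rewrite in_itv/= => /andP[t0 t1].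
  have d1 := is_derive_powR_antiderivative _ (2 * p) _ t0.
  have d2 := is_derive_powR_antiderivative _ s _ t0.
  have d3 := is_derive_powR_onem _ s _ t1.
  have d23 := is_deriveZ ((s + 1) * (Q * q))^-1
    (is_deriveB (is_deriveZ A d2) (is_deriveZ B d3)).
  apply: (is_derive_eq (is_deriveZ K (is_deriveD (is_deriveZ p^-1 d1) d23))).
  rewrite /dW /P /GRing.scale/=; field.
  by rewrite !gt_eqF.
- have cp := within_continuous_powR p1; have cs := within_continuous_powR s1.
  have co := within_continuous_powR_onem s1.
  move=> t; apply: cvgM; first exact: cvg_cst.
  apply: cvgD; first by apply: cvgM; [exact: cvg_cst|exact: cp].
  apply: cvgM; first exact: cvg_cst.
  by apply: cvgB; (apply: cvgM; first exact: cvg_cst); [exact: cs|exact: co].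
- move=> t t01; apply: young_weighted => //; last exact: hk.
  by move: t01; rewrite in_itv/= => /andP[/ltW].
Qed.

(** * Continuity from differentiability relative to a set *)

Lemma derivable_within_cvg {R : realType} {I : set R} {f : R -> R} {y : R} :
  derivable_within I f y -> f @ within I (nbhs y) --> f y.
Proof.
move=> /cvg_ex[/= l hl].
(* Properness is not claimed: this filter is proper only when y is a limit point of I. *)
have FF : Filter (within [set h | I (h + y)] (0 : R)^').
  exact: within_filter.
have h0 : h @[h --> within [set h | I (h + y)] (0 : R)^'] --> (0 : R).
  move=> P hP; rewrite nbhs_simpl /=.
  by apply: filterS (nbhs_dnbhs hP) => h + _; exact.
(* For nonzero h, f (h + y) is h times the difference quotient plus f y, and the product tends to
   0. *)
have := cvgD (cvgM h0 hl) (cvg_cst (f y)).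
move=> /(_ FF FF FF); rewrite mul0r add0r => hf P Pf.
have hP : \forall h \near (0 : R), h != 0 -> I (h + y) ->
  P (h * (h^-1 *: (f (h + y) - f y)) + f y) := hf P Pf.
rewrite nbhs_simpl /= /within /=.
suff : \forall z \near (0 : R), ([set z | I z -> P (f z)] \o shift (y - 0)) z.
  by rewrite -near_shift.
rewrite subr0; apply: filterS hP => h /= + Ih.
(* The punctured filter says nothing at h = 0, but there the value is f y itself, which lies in each
   of its neighbourhoods. *)
have [->|h0' /(_ isT Ih)] := eqVneq h 0.
  by rewrite add0r => _; exact: nbhs_singleton.
by rewrite /GRing.scale/= mulrA divff// mul1r subrK.
Qed.

Lemma within_continuous_derivable_within {R : realType} {I A : set R} {f : R -> R} :
  A `<=` I -> (forall y, A y -> derivable_within I f y) ->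
  {within A, continuous f}.
Proof.
move=> AI df; apply/subspace_continuousP => y Ay.
apply: cvg_trans (derivable_within_cvg (df y Ay)).
apply: cvg_app; exact: within_subset.
Qed.

(** * The second-order expansion between an arbitrary base point and x *)

(** The segment from c to x is rescaled to [0, 1], which reduces the claim to
    [norm_increment_le_s_convex]. No order between c and x is assumed, so one statement serves both
    endpoints. *)
Lemma norm_taylor2_le_s_convex (R : realType) (F f g h : R -> R)
    (a b c x p q s : R) :
  0 < p -> 0 < q -> p^-1 + q^-1 = 1 -> 0 < s -> a < b ->
  c \in `[a, b] -> x \in `[a, b] ->
  (forall u, u \in `]a, b[ -> is_derive u 1 F (f u)) ->
  (forall u, u \in `]a, b[ -> is_derive u 1 f (g u)) ->
  (forall u, u \in `]a, b[ -> is_derive u 1 g (h u)) ->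
  {within `[a, b], continuous F} -> {within `[a, b], continuous f} ->
  {within `[a, b], continuous g} ->
  s_convex_second s a b (fun u => `|h u| `^ q) ->
  `|F x - F c - (x - c) * f x + 2^-1 * (x - c) ^+ 2 * g x| <=
    `|x - c| ^+ 3 / 2 * (2 * p + 1)^-1 `^ p^-1 *
      ((`|h x| `^ q + `|h c| `^ q) / (s + 1)) `^ q^-1.
Proof.
move=> p0 q0 pq s0 ab cab xab dF df dg cF cf cg hconv.
have [->|xc] := eqVneq x c.
  by rewrite !subrr normr0 !expr0n/= !mulr0 !mul0r subr0 addr0 normr0.
have xc0 : x - c != 0 by rewrite subr_eq0.
pose v (t : R) := c + t * (x - c).
pose E u := F u - F c - (u - c) * f u + 2^-1 * (u - c) ^+ 2 * g u.
(* The factor is chosen so that D' (t) = t^2 h (v t): the chain rule gives x - c, and (v t - c)^2 /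
   2 gives t^2 (x - c)^2 / 2. *)
pose D t := 2 / (x - c) ^+ 3 * E (v t).
pose A := `|h x| `^ q; pose B := `|h c| `^ q.
have v_cc (t : R) : t \in `[0, 1] -> v t \in `[a, b].
  move: xab cab; rewrite !in_itv/= => /andP[? ?] /andP[? ?] /andP[? ?].
  by rewrite /v; apply/andP; split; nra.
(* Strictness needs x and c distinct; the two orders are treated separately. *)
have v_oo (t : R) : t \in `]0, 1[ -> v t \in `]a, b[.
  move: xab cab xc; rewrite !in_itv/= => /andP[? ?] /andP[? ?] xc /andP[? ?].
  have [|] := ltP x c => ?.
    by rewrite /v; apply/andP; split; nra.
  have ? : c < x by rewrite lt_neqAle eq_sym xc.
  by rewrite /v; apply/andP; split; nra.
have dE u : u \in `]a, b[ -> is_derive u 1 E (2^-1 * (u - c) ^+ 2 * h u).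
  move=> uab.
  have dl : is_derive u 1 (fun u : R => u - c) 1.
    have := is_deriveB (is_derive_id u 1) (is_derive_cst c u 1).
    by rewrite subr0.
  have := is_deriveD (is_deriveB (is_deriveB (dF u uab) (is_derive_cst (F c) u 1))
    (is_deriveM dl (df u uab)))
    (is_deriveM (is_deriveZ 2^-1 (is_deriveX 2 dl)) (dg u uab)).
  move=> /is_derive_eq; apply.
  by rewrite /GRing.scale/= !fctE /GRing.scale/=; field.
have dD (t : R) : t \in `]0, 1[ -> is_derive t 1 D (t ^+ 2 * h (v t)).
  move=> t01; have dv : is_derive t 1 v (x - c).
    have := is_deriveD (is_derive_cst c t 1)
      (is_deriveM (is_derive_id t 1) (is_derive_cst (x - c) t 1)).
    move=> /is_derive_eq; apply.
    by rewrite /GRing.scale/= mulr0 mulr1 !add0r.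
  have := is_deriveZ (2 / (x - c) ^+ 3)
    (@is_derive1_comp R E v t _ _ (dE _ (v_oo _ t01)) dv).
  move=> /is_derive_eq; apply.
  by rewrite /GRing.scale/= /v; field.
have cE : {within `[a, b], continuous E}.
  have cl : {within `[a, b], continuous (fun u : R => u - c)}.
    by apply: continuous_subspaceT => u; apply: cvgB; [exact: cvg_id|exact: cvg_cst].
  move=> u; apply: cvgD.
    apply: cvgB; first by apply: cvgB; [exact: cF|exact: cvg_cst].
    by apply: cvgM; [exact: cl|exact: cf].
  apply: cvgM; last exact: cg.
  by apply: cvgM; [exact: cvg_cst|apply: cvgM; exact: cl].
have cD : {within `[0, 1], continuous D}.
  have cv : {within `[0, 1], continuous v}.
    apply: continuous_subspaceT => t; apply: cvgD; first exact: cvg_cst.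
    by apply: cvgM; [exact: cvg_id|exact: cvg_cst].
  move=> t; apply: cvgM; first exact: cvg_cst.
  exact: (within_continuous_comp_in cv cE v_cc).
(* The point v t is the convex combination t x + (1 - t) c. *)
have hk (t : R) : t \in `]0, 1[ -> `|h (v t)| `^ q <= t `^ s * A + (1 - t) `^ s * B.
  move=> /subset_itv_oo_cc t01.
  have := hconv x c t xab cab t01.
  by rewrite (_ : _ + _ * c = v t)//; rewrite /v; ring.
have A0 : 0 <= A := powR_ge0 _ _.
have B0 : 0 <= B := powR_ge0 _ _.
have := norm_increment_le_s_convex A0 B0 p0 q0 pq s0 dD cD hk.
have -> : D 0 = 0.
  by rewrite /D /E /v mul0r addr0; ring.
have -> : D 1 = 2 / (x - c) ^+ 3 * E x.
  by rewrite /D (_ : v 1 = x)// /v; ring.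
rewrite subr0 normrM normrM normfV normrX ger0_norm// => le_E.
have n0 : 0 < `|x - c| ^+ 3 / 2.
  by apply: divr_gt0 => //; apply: exprn_gt0; rewrite normr_gt0.
rewrite -[leRHS]mulrA -ler_pdivrMl//.
by rewrite invf_div.
Qed.

Theorem theorem5 (R : realType) (I : set R) (f : R -> R) (a b p q s : R)
    (hI : is_interval I) (hI0 : I `<=` [set y | 0 <= y])
    (ha : I a) (hb : I b) (hab : a < b)
    (hf : twice_derivable_within I I° f)
    (hfab : twice_derivable_within I `[a, b] f)
    (hint : lebesgue_measure.-integrable `[a, b]
      (fun u => (derive1_within I (derive1_within I f) u)%:E))
    (hp : 1 < p) (hq : 1 < q) (hpq : 1 / p + 1 / q = 1)
    (hs0 : 0 < s) (hs1 : s <= 1)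
    (hconv : s_convex_second s a b
      (fun u => `|derive1_within I (derive1_within I f) u| `^ q))
    (x : R) (hx : x \in `[a, b]) :
  `| 1 / (b - a) * (\int[lebesgue_measure]_(u in `[a, b]) f u) - f x
     + (x - (a + b) / 2) * derive1_within I f x |
  <= (x - a) ^+ 3 / (2 * (b - a)) * (1 / (2 * p + 1)) `^ (1 / p)
     * ((`|derive1_within I (derive1_within I f) x| `^ q
         + `|derive1_within I (derive1_within I f) a| `^ q) / (s + 1)) `^ (1 / q)
   + (b - x) ^+ 3 / (2 * (b - a)) * (1 / (2 * p + 1)) `^ (1 / p)
     * ((`|derive1_within I (derive1_within I f) x| `^ q
         + `|derive1_within I (derive1_within I f) b| `^ q) / (s + 1)) `^ (1 / q).
Proof.
set g := derive1_within I f in hconv *; set h := derive1_within I g in hconv *.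
pose F (u : R) := \int[lebesgue_measure]_(t in `[a, u]) f t.
have abI : `[a, b] `<=` I by move=> u /=; rewrite in_itv/=; exact: hI.
have oo_int : forall u : R, u \in `]a, b[ -> I° u.
  have oab : open (`]a, b[%classic : set R) by exact: interval_open.
  suff : `]a, b[ `<=` I° by move=> H u; exact: H.
  rewrite -(open_subsetE _ oab).
  by apply: subset_trans abI; exact: subset_itv_oo_cc.
(* Continuity up to a and b comes from the derivatives relative to I, one-sided at an endpoint of
   I. *)
have cf : {within `[a, b], continuous f}.
  by apply: (within_continuous_derivable_within abI) => y /hfab[].
have cg : {within `[a, b], continuous g}.
  by apply: (within_continuous_derivable_within abI) => y /hfab[].
have intf : lebesgue_measure.-integrable `[a, b] (EFin \o f).
  by apply: continuous_compact_integrable => //; exact: segment_compact.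
have cF := parameterized_integral_continuous (ltW hab) intf.
have dF : forall u : R, u \in `]a, b[ -> is_derive u 1 F (f u).
  move=> u uab; have := within_continuous_continuous hab cf uab => cfu.
  move: (uab); rewrite in_itv/= => /andP[au ub].
  have [? e] := continuous_FTC1_closed ub intf au cfu.
  by rewrite -e derive1E; exact: derivableP.
have df : forall u : R, u \in `]a, b[ -> is_derive u 1 f (g u).
  move=> u /oo_int Iu; have [/(derivable_within_interior _ Iu) ? _] := hf _ Iu.
  by rewrite /g derive1_within_interior// derive1E; exact: derivableP.
have dg : forall u : R, u \in `]a, b[ -> is_derive u 1 g (h u).
  move=> u /oo_int Iu; have [_ /(derivable_within_interior _ Iu) ?] := hf _ Iu.
  by rewrite /h derive1_within_interior// derive1E; exact: derivableP.
(* Transparent [g] and [h] would be unfolded when comparing [h x] with [h a]. *)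
clearbody h g.
have p0 : 0 < p := lt_trans ltr01 hp.
have q0 : 0 < q := lt_trans ltr01 hq.
have aab : a \in `[a, b] by rewrite in_itv/= lexx ltW.
have bab : b \in `[a, b] by rewrite in_itv/= lexx ltW.
move: hpq (hx); rewrite in_itv/= !div1r => pq /andP[ax xb].
have bound c cab := norm_taylor2_le_s_convex _ _ _ _ _ _ _ c _ _ _ _ p0 q0 pq hs0 hab
  cab hx dF df dg cF cf cg hconv.
have := bound _ bab; have := bound _ aab.
rewrite (_ : F a = 0) ?subr0; last by rewrite /F set_itv1 Rintegral_set1.
rewrite (distrC x b) (ger0_norm (_ : 0 <= b - x)) ?subr_ge0//.
rewrite [`|x - a|]ger0_norm ?subr_ge0// -/(F b).
set Ea := F x - _ + _; set Eb := F x - _ - _ + _ => le_Ea le_Eb.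
have ba0 : 0 < b - a by rewrite subr_gt0.
(* In Ea - Eb the terms in F x cancel, those in f x add up to -(b - a) f x, and ((x - a)^2 - (x -
   b)^2) / 2 = (b - a) (x - (a + b) / 2). *)
rewrite (_ : _ + _ * g x = (Ea - Eb) / (b - a)); last first.
  by rewrite /Ea /Eb; field; rewrite gt_eqF.
rewrite normrM normfV (gtr0_norm ba0) ler_pdivrMr//.
apply: le_trans (ler_normB _ _) _; apply: le_trans (lerD le_Ea le_Eb) _.
rewrite le_eqVlt; apply/predU1P; left.
(* The real powers become variables, so that what remains is a field identity. *)
move: (_ `^ p^-1) (_ `^ q^-1) (_ `^ q^-1) => P Ka Kb.
by field; rewrite gt_eqF.
Qed.
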